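(* Let $\mu$ be a symmetric non-atomic Borel probability measure on $[0,1]$, i.e. $\mu([0,x])=\mu([1-x,1])$ for all $x\in[0,1]$. Then the Dirichlet eigenfunctions $f_{D,m}$ ($m\in\mathbb{N}$) are either symmetric or antisymmetric, that is, for each $m$ either $$f_{D,m}(x)=f_{D,m}(1-x)\ \text{ for all }x\in[0,1]\qquad\text{or}\qquad f_{D,m}(x)=-f_{D,m}(1-x)\ \text{ for all }x\in[0,1].$$
   Context: Derivatives with respect to a measure: for a non-atomic Borel probability measure $\nu$ on $[0,1]$ and $f\colon[0,1]\to\mathbb{R}$, a function $h\in L_2([0,1],\nu)$ is the $\nu$-derivative of $f$, written $\frac{df}{d\nu}$, if $f(x)=f(0)+\int_0^x h\,d\nu$ for all $x\in[0,1]$. $H^1(\nu)$ is the space of functions possessing a $\nu$-derivative; such functions are continuous. For the Lebesgue measure the derivative is written $f'$. $H^2(\lambda,\mu)$ (index $\lambda$: Lebesgue measure) is the space of all $f$ possessing a Lebesgue derivative $f'$ (that is, $f'$ is square-integrable with respect to Lebesgue measure and $f(x)=f(0)+\int_0^x f'(t)\,dt$ for all $x\in[0,1]$) that belongs to $H^1(\mu)$ (so $f'$ is taken to be the continuous representative). A Dirichlet eigenvalue is a real $\Lambda$ such that there is a non-zero $f\in H^2(\lambda,\mu)$ with $\frac{d}{d\mu}f'=-\Lambda f$ and $f(0)=f(1)=0$. The Dirichlet eigenvalues form a strictly increasing sequence $0<\lambda_{D,1}<\lambda_{D,2}<\cdots\to\infty$; they are exactly the squares of the positive zeros of $\sin_\mu^D(z)=\sum_{n\ge0}(-1)^n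 q_{2n+1}(1)z^{2n+1}$. The eigenfunction for $\lambda_{D,m}$ is (normalized as) $f_{D,m}(x)=s_{\lambda,\mu}(\sqrt{\lambda_{D,m}},x)$, where $s_{\lambda,\mu}(z,x)=\sum_{n\ge0}(-1)^n z^{2n+1}q_{2n+1}(x)$. Here $q_0(x)=1$ and, for $n\ge1$, $q_n(x)=\int_0^x q_{n-1}(t)\,dt$ if $n$ is odd, $q_n(x)=\int_0^x q_{n-1}\,d\mu$ if $n$ is even. *)

(* Defs.v *)
From HB Require Import structures.
From mathcomp Require Export all_boot all_order all_algebra.
From mathcomp Require Export all_classical all_reals all_analysis.
Export Order.TTheory GRing.Theory Num.Theory.
Export numFieldNormedType.Exports.

Set Implicit Arguments.
Unset Strict Implicit.
Unset Printing Implicit Defensive.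

Local Open Scope classical_set_scope.
Local Open Scope ring_scope.

(* Borel measures on [0, 1] are represented by Borel measures on the line;
   a probability measure on [0, 1] is one that gives [0, 1] mass one.
   Functions on [0, 1] are represented by functions on the line of which only
   the values on [0, 1] matter. *)

Definition on_unit_interval (R : realType)
    (mu : probability (measurableTypeR R) R) : Prop :=
  mu `[0, 1]%classic = 1%E.

(* On the line, having no atoms is equivalent to having no point masses. *)
Definition non_atomic (R : realType)
    (mu : probability (measurableTypeR R) R) : Prop :=
  forall x : R, mu [set x] = 0%E.

Definition symmetric_measure (R : realType)
    (mu : probability (measurableTypeR R) R) : Prop :=
  forall x : R, x \in `[0, 1] -> mu `[0, x]%classic = mu `[1 - x, 1]%classic.

(* h is in L_2([0, 1], nu); the values of h off [0, 1] are discarded. *)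
Definition L2_unit (R : realType)
    (nu : {measure set (measurableTypeR R) -> \bar R}) (h : R -> R) : Prop :=
  (h \_ `[0, 1]%classic : measurableTypeR R -> R) \in Lfun nu 2%:E.

(* h is a nu-derivative of f. As a class in L_2, df/dnu is unique, and
   "df/dnu = h" means that the function h is a representative of it. *)
Definition is_nu_derivative (R : realType)
    (nu : {measure set (measurableTypeR R) -> \bar R}) (f h : R -> R) : Prop :=
  L2_unit nu h /\
  forall x : R, x \in `[0, 1] ->
    f x = f 0 + \int[nu]_(t in `[0, x]) h t.

(* The function g below is a Lebesgue derivative of f; having itself a
   mu-derivative, it is the continuous representative of f' on [0, 1], so that
   f is in H^2(lambda, mu) and d/dmu f' = - Lam f. *)
Definition dirichlet_eigenvalue (R : realType)
    (mu : probability (measurableTypeR R) R) (Lam : R) : Prop :=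
  exists f g : R -> R,
    [/\ is_nu_derivative (@lebesgue_measure R) f g,
        is_nu_derivative mu g (fun x => - Lam * f x),
        f 0 = 0, f 1 = 0
      & exists2 x : R, x \in `[0, 1] & f x != 0].

(* lamD 0 < lamD 1 < ... is the list of all the Dirichlet eigenvalues; the
   indices are shifted by one: lamD m stands for lambda_{D,m+1}. *)
Definition dirichlet_eigenvalues_are (R : realType)
    (mu : probability (measurableTypeR R) R) (lamD : nat -> R) : Prop :=
  (forall m n : nat, (m < n)%N -> lamD m < lamD n) /\
  (forall Lam : R,
     dirichlet_eigenvalue mu Lam <-> exists m : nat, Lam = lamD m).

Fixpoint q (R : realType) (mu : probability (measurableTypeR R) R)
    (n : nat) (x : R) : R :=
  match n with
  | 0%N => 1
  | n'.+1 =>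
      if odd n then \int[@lebesgue_measure R]_(t in `[0, x]) q mu n' t
      else \int[mu]_(t in `[0, x]) q mu n' t
  end.

Definition s_lambda_mu (R : realType)
    (mu : probability (measurableTypeR R) R) (z x : R) : R :=
  limn (series (fun n : nat =>
    (-1) ^+ n * z ^+ (2 * n + 1) * q mu (2 * n + 1) x)).

Definition dirichlet_eigenfunction (R : realType)
    (mu : probability (measurableTypeR R) R) (lamD : nat -> R)
    (m : nat) (x : R) : R :=
  s_lambda_mu mu (Num.sqrt (lamD m)) x.

(* Main.v *)
(* An eigenfunction [f] and its derivative [g] solve
     f(x) = int_0^x g dlambda,   g(x) = g(0) - Lam int_0^x f dmu.
   Iterating, f(x) = g(0) sum_(n < N) (-Lam)^n q_(2n+1)(x) + u_N(x), where
   |u_N(x)| <= M Lam^N x^N / N!, so that g(0) s(sqrt Lam, x) = sqrt Lam f(x):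
   solutions vanishing at 0 are proportional to S = s(sqrt Lam, -).
   As mu and lambda are both symmetric, x |-> f(1 - x) is again a solution, and
   it vanishes at 0 because f(1) = 0. Hence S(1 - x) = c S(x), and reflecting
   twice gives c^2 = 1. For Lam <= 0 the junk value sqrt Lam = 0 makes S = 0. *)

Require Import Defs.
From mathcomp Require Import ring lra.
From mathcomp Require Import measurable_realfun.

Local Open Scope classical_set_scope.
Local Open Scope ring_scope.

Set Implicit Arguments.
Unset Strict Implicit.
Unset Printing Implicit Defensive.

(** * Bounded functions and primitives for a measure of mass one on [0, 1] *)

Section unit_mass.
Variables (R : realType) (nu : {measure set (measurableTypeR R) -> \bar R}).
Hypothesis nu01 : nu `[0, 1]%classic = 1%E.

(** A class integrable for [mu] and Lebesgue measure alike, and stable under the linear operations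
    and reflections below; square-integrability matters only when an eigenvalue is unpacked. *)
Definition unit_bounded (h : R -> R) : Prop :=
  measurable_fun (`[0, 1]%classic : set R) h /\
  exists M : R, forall x : R, x \in `[0, 1] -> `|h x| <= M.

Lemma sub_unit_itv (x : R) : x \in `[0, 1] ->
  `[0, x]%classic `<=` `[0, 1]%classic.
Proof.
move=> x01; apply: subset_itvl; rewrite bnd_simp.
by move: x01; rewrite in_itv/= => /andP[].
Qed.

Lemma unit_mass_le1 (D : set (measurableTypeR R)) : measurable D ->
  D `<=` `[0, 1]%classic -> (nu D <= 1)%E.
Proof. by move=> mD D01; rewrite -nu01 le_measure// inE. Qed.

Lemma unit_bounded_integrable (h : R -> R) (D : set (measurableTypeR R)) :
  measurable D -> D `<=` `[0, 1]%classic -> unit_bounded h ->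
  nu.-integrable D (EFin \o h).
Proof.
move=> mD D01 [mh [M hM]]; apply: measurable_bounded_integrable => //.
- by rewrite (le_lt_trans (unit_mass_le1 mD D01))// ltry.
- exact: measurable_funS D01 mh.
- exists M; split; first by rewrite num_real.
  by move=> y My x Dx /=; rewrite (le_trans (hM x _))// ?ltW//; exact: D01.
Qed.

Lemma normr_unit_Rintegral_le (h : R -> R) (D : set (measurableTypeR R)) (M : R) :
  measurable D -> D `<=` `[0, 1]%classic -> unit_bounded h -> 0 <= M ->
  (forall x, D x -> `|h x| <= M) -> `|\int[nu]_(x in D) h x| <= M.
Proof.
move=> mD D01 bh M0 hM; have ih := unit_bounded_integrable mD D01 bh.
rewrite (le_trans (le_normr_Rintegral mD ih))//.
rewrite (@le_trans _ _ (\int[nu]_(x in D) M))//.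
  apply: le_Rintegral => //.
  - exact: integrable_norm ih.
  - apply: (unit_bounded_integrable mD D01); split => //.
    by exists `|M| => x _.
rewrite Rintegral_cst// ler_piMr//.
rewrite -[leRHS]/(fine 1%:E) fine_le ?unit_mass_le1//.
by rewrite ge0_fin_numE// (le_lt_trans (unit_mass_le1 mD D01))// ltry.
Qed.

Lemma unit_boundedZ (c : R) (h : R -> R) :
  unit_bounded h -> unit_bounded (fun x => c * h x).
Proof.
move=> [mh [M hM]]; split; first exact: measurable_funM.
by exists (`|c| * M) => x x01; rewrite normrM ler_wpM2l// hM.
Qed.

Lemma unit_boundedB (h1 h2 : R -> R) : unit_bounded h1 -> unit_bounded h2 ->
  unit_bounded (fun x => h1 x - h2 x).
Proof.
move=> [mh1 [M1 hM1]] [mh2 [M2 hM2]]; split; first exact: measurable_funB.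
exists (M1 + M2) => x x01.
by rewrite (le_trans (ler_normB _ _))// lerD ?hM1 ?hM2.
Qed.

(* The primitive of a nonnegative function is measurable because it is monotone. *)
Lemma unit_bounded_primitive (h : R -> R) : unit_bounded h ->
  (forall x, x \in `[0, 1] -> 0 <= h x) ->
  unit_bounded (fun x => \int[nu]_(t in `[0, x]) h t).
Proof.
move=> bh h0; split.
  (* Cutting off at [0, 1] makes the primitive monotone on the whole line, although [h] is
     controlled only on [0, 1]. *)
  pose F (x : R) := \int[nu]_(t in `[0, x] `&` `[0, 1]) h t.
  apply: (eq_measurable_fun F) => [x|].
    by rewrite inE => /= x01; congr Rintegral; rewrite setIidl//;
       exact: sub_unit_itv.
  apply: nondecreasing_measurable => // x y xy.
  have int z : nu.-integrable (`[0, z] `&` `[0, 1]) (EFin \o h).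
    by apply: unit_bounded_integrable => //; exact: measurableI.
  rewrite fine_le ?integrable_fin_num//; [exact: measurableI..|].
  apply: ge0_subset_integral; [exact: measurableI..| | |].
  - exact: measurable_int (int y).
  - by move=> t [_ t01]; rewrite lee_fin h0.
  - by apply: setSI; apply: subset_itvl; rewrite bnd_simp.
have [_ [M hM]] := bh; exists `|M| => x x01.
apply: normr_unit_Rintegral_le => //; first exact: sub_unit_itv.
move=> t tx; rewrite (le_trans (hM t _)) ?ler_norm//.
exact: (sub_unit_itv x01 tx).
Qed.

(** * The reflection t |-> 1 - t for symmetric measures *)

Hypothesis nu_non_atomic : forall x : R, nu [set x] = 0%E.
Hypothesis nu_symmetric : forall x : R, x \in `[0, 1] ->
  nu `[0, x]%classic = nu `[1 - x, 1]%classic.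


(** Symmetry is assumed on intervals only. The open rays form a pi-system generating the Borel sets,
    so agreement on their traces on [0, 1] suffices. *)
Lemma measure_reflection (A : set (measurableTypeR R)) : measurable A ->
  A `<=` `[0, 1]%classic ->
  nu A = pushforward nu (fun t : measurableTypeR R => 1 - t : measurableTypeR R) A.
Proof.
move=> mA A01.
pose phi (t : measurableTypeR R) : measurableTypeR R := 1 - t.
have m01 : measurable (`[0, 1]%classic : set (measurableTypeR R)) by [].
have mphi : measurable_fun setT phi by exact: measurable_funB.
(* Uniqueness needs generators of finite mass exhausting the line. Lebesgue measure gives rays
   infinite mass, so both measures are first restricted to [0, 1]. *)
rewrite -[in LHS](setIidl A01) -[in RHS](setIidl A01).
pose pnu :=
  measure_function_pushforward__canonical__measure_function_Measure nu mphi.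
apply: (@measure_unique _ R (measurableTypeR R) (@RGenInftyO.G R)
  (fun n => `]-oo, n%:R[%classic) _ _ _ _ (mrestr nu m01) (mrestr pnu m01)) => //.
- exact: RGenInftyO.measurableE.
- move=> _ _ [x ->] [y ->]; exists (Num.min x y).
  by apply/seteqP; split => t /=; rewrite !in_itv/= lt_min; [case=> -> ->|case/andP].
- by move=> n; exists n%:R.
- apply/seteqP; split => // t _; exists (Num.truncn t).+1 => //=.
  by rewrite in_itv/= truncnS_gt.
- move=> _ [x ->]; change (nu (`]-oo, x[%classic `&` `[0, 1]%classic) =
    nu (phi @^-1` `]-oo, x[%classic `&` phi @^-1` `[0, 1]%classic)).
  have -> : phi @^-1` `[0, 1]%classic = `[0, 1]%classic.
    by apply/seteqP; split => t; rewrite /phi/= !in_itv/= => /andP[? ?]; lra.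
  have [x0|x0] := leP x 0.
    have -> : `]-oo, x[%classic `&` `[0, 1]%classic = set0.
      by apply/seteqP; split => t //; rewrite /= !in_itv/= => -[? /andP[? ?]]; lra.
    have -> : phi @^-1` `]-oo, x[%classic `&` `[0, 1]%classic = set0.
      by apply/seteqP; split => t //; rewrite /phi/= !in_itv/=;
        case=> ? /andP[? ?]; lra.
    by [].
  have [x1|x1] := ltP 1 x.
    by congr (nu _); apply/seteqP; split => t [];
      rewrite /phi/= !in_itv/= => ? /andP[? ?]; lra.
  have x01 : x \in `[0, 1] by rewrite in_itv/= ltW.
  (* The closed intervals [0, x] and [1 - x, 1] exceed the two sets to be compared by one point
     each, which has measure zero. *)
  have := nu_symmetric x01.
  have -> : `[0, x]%classic = (`]-oo, x[%classic `&` `[0, 1]%classic) `|` [set x].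
    apply/seteqP; split => t /=; rewrite !in_itv/=.
      case/andP=> t0; rewrite le_eqVlt => /predU1P[->|tx]; [by right|left]; lra.
    by case=> [|->]; lra.
  have -> : `[1 - x, 1]%classic =
      (phi @^-1` `]-oo, x[%classic `&` `[0, 1]%classic) `|` [set 1 - x].
    apply/seteqP; split => t /=; rewrite /phi !in_itv/=.
      case/andP; rewrite le_eqVlt => /predU1P[->|tx]; [by right|left]; lra.
    by case=> [|->]; lra.
  have mL y : measurable (`]-oo, y[%classic `&` `[0, 1]%classic :
    set (measurableTypeR R)) by exact: measurableI.
  have mphiL : measurable (phi @^-1` `]-oo, x[%classic `&` `[0, 1]%classic).
    by apply: measurableI => //; rewrite -[X in measurable X]setTI; exact: (mphi).
  by rewrite !measureU0.
- move=> k; rewrite /= /mrestr.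
  rewrite (le_lt_trans (unit_mass_le1 _ _)) ?ltry//; exact: measurableI.
Qed.

Lemma in_unit_itvC (x : R) : (1 - x \in `[0, 1]) = (x \in `[0, 1]).
Proof. by rewrite !in_itv/= subr_ge0 lerBlDr lerDl andbC. Qed.

Lemma unit_boundedC (h : R -> R) : unit_bounded h ->
  unit_bounded (fun t => h (1 - t)).
Proof.
move=> [mh [M hM]]; split; last first.
  by exists M => x x01; rewrite hM// in_unit_itvC.
refine (@measurable_comp _ _ _ R R R `[0, 1]%classic h _
  (fun t : R => 1 - t) _ _ mh _) => //.
- by move=> _ [x /= x01 <-]; rewrite in_unit_itvC.
- exact: measurable_funB.
Qed.

Lemma Rintegral_reflection (h : R -> R) (x : R) : unit_bounded h ->
  x \in `[0, 1] ->
  \int[nu]_(t in `[1 - x, 1]) h t = \int[nu]_(t in `[0, x]) h (1 - t).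
Proof.
move=> bh x01.
pose phi (t : measurableTypeR R) : measurableTypeR R := 1 - t.
have mphi : measurable_fun setT phi by exact: measurable_funB.
pose pnu :=
  measure_function_pushforward__canonical__measure_function_Measure nu mphi.
have x1S : `[1 - x, 1]%classic `<=` `[0, 1]%classic.
  apply: subset_itvr; rewrite bnd_simp.
  by move: x01; rewrite in_itv/= => /andP[]; lra.
have phix : phi @^-1` `[1 - x, 1]%classic = `[0, x]%classic.
  by apply/seteqP; split => t; rewrite /phi/= !in_itv/= => /andP[? ?]; lra.
(* Integration against the pushforward asks for measurability on the whole line, hence the extension
   by zero. *)
pose h0 : R -> R := h \_ `[0, 1]%classic.
have h0E t : t \in `[0, 1] -> h0 t = h t by move=> t01; rewrite /h0 patchT// inE.
rewrite (eq_Rintegral nu (g := h0)); last first.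
  by move=> t; rewrite inE => /= tx; rewrite h0E//; exact: x1S.
rewrite [RHS](eq_Rintegral nu (g := fun t => h0 (1 - t))); last first.
  move=> t; rewrite inE => /= tx; rewrite h0E// in_unit_itvC.
  exact: (sub_unit_itv x01 tx).
rewrite /Rintegral (@eq_measure_integral _ _ _ _ pnu); last first.
  by move=> A mA Ax; apply: measure_reflection => //; exact: subset_trans Ax x1S.
have mh0 : measurable_fun [set: R] h0.
  have [mh _] := bh.
  exact: (proj1 (measurable_restrictT h (measurable_itv `[0, 1])) mh).
rewrite integral_pushforward//.
- by rewrite phix.
- exact/measurable_EFinP.
- rewrite phix; apply: (unit_bounded_integrable (h := fun t => h0 (1 - t))) => //.
    exact: sub_unit_itv.
  apply: unit_boundedC; split; first exact: measurable_funS mh0.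
  have [_ [M hM]] := bh.
  by exists M => t t01; rewrite h0E ?hM.
Qed.

(** Split [0, 1] at 1 - x and reflect the upper piece. The point 1 - x, shared by both closed
    pieces, is null. *)
Lemma Rintegral_unit_primitiveC (h : R -> R) (x : R) : unit_bounded h ->
  x \in `[0, 1] ->
  \int[nu]_(t in `[0, 1 - x]) h t =
  \int[nu]_(t in `[0, 1]) h t - \int[nu]_(t in `[0, x]) h (1 - t).
Proof.
move=> bh x01; rewrite -Rintegral_reflection//.
have /andP[x0 x1] : 0 <= x <= 1 by move: x01; rewrite in_itv.
have ox : `]1 - x, 1]%classic `<=` `[0, 1]%classic.
  by move=> t /=; rewrite !in_itv/= => /andP[? ?]; lra.
have int01 := unit_bounded_integrable (measurable_itv `[0, 1]) (@subset_refl _ _) bh.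
have -> : \int[nu]_(t in `[1 - x, 1]) h t = \int[nu]_(t in `]1 - x, 1]) h t.
  rewrite -(@setU1itv _ _ (BRight 1) (1 - x) false) ?bnd_simp; last by lra.
  rewrite Rintegral_setU//.
  - rewrite [X in X + _](_ : _ = 0) ?add0r//.
    rewrite /Rintegral null_set_integral//.
    apply/measurable_EFinP; apply: (measurable_funS _ _ (proj1 bh)) => //.
    by move=> t ->; rewrite /= in_unit_itvC.
  - rewrite setU1itv ?bnd_simp; last by lra.
    apply: unit_bounded_integrable => // t /=; rewrite !in_itv/= => /andP[? ?]; lra.
  - by apply/disj_setPS => t [/= ->]; rewrite in_itv/= ltxx.
rewrite (@itv_bndbnd_setU _ _ (BLeft 0) (BRight (1 - x)) (BRight 1)) ?bnd_simp;
  [|lra..].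
rewrite Rintegral_setU ?addrK//.
- by rewrite -itv_bndbnd_setU ?bnd_simp//; lra.
- by apply/disj_setPS => t [/=]; rewrite !in_itv/= => /andP[? ?] /andP[? ?]; lra.
Qed.

End unit_mass.

(** * Lebesgue measure on [0, 1] *)

Section lebesgue_unit.
Variable R : realType.
Local Notation lambda := (@lebesgue_measure R).

Lemma lebesgue_unit_itv : lambda `[0, 1]%classic = 1%E.
Proof. by rewrite lebesgue_measure_itv/= lte_fin ltr01 oppr0 adde0. Qed.

Lemma lebesgue_symmetric (x : R) : x \in `[0, 1] ->
  lambda `[0, x]%classic = lambda `[1 - x, 1]%classic.
Proof.
rewrite in_itv/= => /andP[x0 x1].
rewrite !lebesgue_measure_itv/= !lte_fin ltrBlDl ltrDr.
by case: ifP => // _; rewrite -!EFinB; congr (_%:E); lra.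
Qed.

(** Source of the factorials in the remainder estimate. *)
Lemma Rintegral_divided_power (N : nat) (x : R) : 0 <= x ->
  \int[lambda]_(t in `[0, x]) (t ^+ N / N`!%:R) = x ^+ N.+1 / N.+1`!%:R.
Proof.
rewrite le_eqVlt => /predU1P[<-|x0].
  by rewrite set_itv1 Rintegral_set1 expr0n mul0r.
have cdp n : continuous (fun t : R => t ^+ n / n`!%:R).
  by move=> t; apply: cvgMl; exact: exprn_continuous.
rewrite /Rintegral (@continuous_FTC2 _ _ (fun t => t ^+ N.+1 / N.+1`!%:R))//=.
- by rewrite expr0n mul0r subr0.
- by apply: continuous_subspaceT; exact: cdp.
- split.
  + move=> t _; apply: derivableM => //; exact: exprn_derivable.
  + apply: cvg_at_right_filter; exact: cdp.
  + apply: cvg_at_left_filter; exact: cdp.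
- move=> t _; rewrite derive1Mr; last exact: exprn_derivable.
  rewrite derive1E exp_derive// factS natrM invfM mulrA; congr (_ * _).
  rewrite /GRing.scale/= mulr1.
  by rewrite mulrAC divff ?mul1r// pnatr_eq0.
Qed.

End lebesgue_unit.

(** * The functions q_n and the first-order system *)

Section iterated_primitives.
Variables (R : realType) (mu : probability (measurableTypeR R) R).
Hypothesis mu01 : on_unit_interval mu.

Lemma q_odd (n : nat) (x : R) :
  q mu n.*2.+1 x = \int[@lebesgue_measure R]_(t in `[0, x]) q mu n.*2 t.
Proof. by rewrite /= odd_double. Qed.

Lemma q_even (n : nat) (x : R) :
  q mu n.*2.+2 x = \int[mu]_(t in `[0, x]) q mu n.*2.+1 t.
Proof. by rewrite /= odd_double. Qed.

(** Nonnegativity is carried through the induction because it makes the next primitive monotone,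
    hence measurable. *)
Lemma q_unit_bounded (n : nat) : unit_bounded (q mu n) /\
  forall x, x \in `[0, 1] -> 0 <= q mu n x.
Proof.
elim: n => [|n [bq q0]] /=.
  split; last by move=> x _; exact: ler01.
  by split; [exact: measurable_cst | exists 1 => x _; rewrite normr1].
case: (odd n); split=> [|x x01]; rewrite /=.
- exact: (unit_bounded_primitive mu01).
- by apply: Rintegral_ge0 => t /(sub_unit_itv x01); exact: q0.
- exact: (unit_bounded_primitive (lebesgue_unit_itv R)).
- by apply: Rintegral_ge0 => t /(sub_unit_itv x01); exact: q0.
Qed.

(* The first-order system equivalent to [f'' = - Lam f] in the sense of
   [H^2(lambda, mu)], with the Dirichlet condition at [0] only. *)
Definition left_dirichlet_system (Lam : R) (f g : R -> R) : Prop :=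
  [/\ unit_bounded f, unit_bounded g,
      forall x, x \in `[0, 1] ->
        f x = \int[@lebesgue_measure R]_(t in `[0, x]) g t
    & forall x, x \in `[0, 1] ->
        g x = g 0 - Lam * \int[mu]_(t in `[0, x]) f t].

(** For Lam = z^2 and z != 0 the sum is a partial sum of s(z, x) / z, written without a square
    root. *)
Definition sine_remainder (Lam : R) (f g : R -> R) (N : nat) (x : R) : R :=
  f x - g 0 * \sum_(n < N) (- Lam) ^+ n * q mu n.*2.+1 x.

(** The companion of [sine_remainder] for the derivative, built on the even-indexed q_n. *)
Definition cosine_remainder (Lam : R) (g : R -> R) (N : nat) (x : R) : R :=
  g x - g 0 * \sum_(n < N) (- Lam) ^+ n * q mu n.*2 x.

(** * Series expansion of solutions and its remainders *)

Section remainders.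
Variables (Lam : R) (f g : R -> R).
Hypothesis fg : left_dirichlet_system Lam f g.
Local Notation u := (sine_remainder Lam f g).
Local Notation v := (cosine_remainder Lam g).

Lemma sine_remainderS (N : nat) (x : R) :
  u N.+1 x = u N x - g 0 * (- Lam) ^+ N * q mu N.*2.+1 x.
Proof. by rewrite /sine_remainder big_ord_recr/= mulrDr opprD addrA mulrA. Qed.

Lemma cosine_remainderS (N : nat) (x : R) :
  v N.+1 x = v N x - g 0 * (- Lam) ^+ N * q mu N.*2 x.
Proof. by rewrite /cosine_remainder big_ord_recr/= mulrDr opprD addrA mulrA. Qed.

Lemma sine_remainder_unit_bounded (N : nat) : unit_bounded (u N).
Proof.
have [bf _ _ _] := fg; elim: N => [|N IHN].
  rewrite (_ : u 0 = f)//; apply/funext => x.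
  by rewrite /sine_remainder big_ord0 mulr0 subr0.
rewrite (funext (sine_remainderS N)).
by apply: unit_boundedB => //; apply: unit_boundedZ; exact: (q_unit_bounded _).1.
Qed.

Lemma cosine_remainder_unit_bounded (N : nat) : unit_bounded (v N).
Proof.
have [_ bg _ _] := fg; elim: N => [|N IHN].
  rewrite (_ : v 0 = g)//; apply/funext => x.
  by rewrite /cosine_remainder big_ord0 mulr0 subr0.
rewrite (funext (cosine_remainderS N)).
by apply: unit_boundedB => //; apply: unit_boundedZ; exact: (q_unit_bounded _).1.
Qed.

(** Subtracting matching terms preserves the first equation of the system, as q_(2N+1) is the
    Lebesgue primitive of q_(2N). *)
Lemma sine_remainder_primitive (N : nat) (x : R) : x \in `[0, 1] ->
  u N x = \int[@lebesgue_measure R]_(t in `[0, x]) v N t.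
Proof.
move=> x01; have [_ _ fE _] := fg.
have int h : unit_bounded h ->
    lebesgue_measure.-integrable `[0, x]%classic (EFin \o h).
  apply: (unit_bounded_integrable (lebesgue_unit_itv R)) => //.
  exact: sub_unit_itv.
have bq n := (q_unit_bounded n).1.
elim: N => [|N IHN].
  rewrite /sine_remainder /cosine_remainder big_ord0 mulr0 subr0 fE//.
  by apply: eq_Rintegral => t _; rewrite big_ord0 mulr0 subr0.
rewrite sine_remainderS IHN q_odd -RintegralZl//; last exact: int.
rewrite -RintegralB//.
- by apply: eq_Rintegral => t _; rewrite cosine_remainderS.
- exact/int/cosine_remainder_unit_bounded.
- exact/int/unit_boundedZ.
Qed.

(** The index shifts by one: the term q_0 = 1 cancels the initial value [g 0], and each later
    q_(2N+2) is the [mu]-primitive of q_(2N+1). *)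
Lemma cosine_remainder_primitive (N : nat) (x : R) : x \in `[0, 1] ->
  v N.+1 x = - Lam * \int[mu]_(t in `[0, x]) u N t.
Proof.
move=> x01; have [_ _ _ gE] := fg.
have int h : unit_bounded h -> mu.-integrable `[0, x]%classic (EFin \o h).
  apply: (unit_bounded_integrable mu01) => //.
  exact: sub_unit_itv.
have bq n := (q_unit_bounded n).1.
elim: N => [|N IHN].
  rewrite /cosine_remainder big_ord1/= expr0 !mulr1 gE// addrAC subrr add0r mulNr.
  congr (- (_ * _)); apply: eq_Rintegral => t _.
  by rewrite /sine_remainder big_ord0 mulr0 subr0.
rewrite cosine_remainderS IHN doubleS q_even.
rewrite [in RHS](eq_Rintegral mu (g := fun t => u N t -
  g 0 * (- Lam) ^+ N * q mu N.*2.+1 t)); last by move=> t _; rewrite sine_remainderS.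
rewrite RintegralB//;
  [|exact/int/sine_remainder_unit_bounded|exact/int/unit_boundedZ].
rewrite RintegralZl//; last exact: int.
by rewrite mulrBr exprS; ring.
Qed.

(** Passing from N to N + 1 integrates once against each measure. The [mu]-integral contributes the
    factor |Lam|, the Lebesgue integral raises the divided power. *)
Lemma sine_remainder_le : exists M : R, forall (N : nat) (x : R),
  x \in `[0, 1] -> `|u N x| <= M * `|Lam| ^+ N * (x ^+ N / N`!%:R).
Proof.
have [[_ [M hM]] _ _ _] := fg; exists `|M|.
elim=> [|N IHN] x x01.
  rewrite /sine_remainder big_ord0 mulr0 subr0 !expr0 mulr1 divr1 mulr1.
  by rewrite (le_trans (hM x x01))// ler_norm.
have x0 : 0 <= x by move: x01; rewrite in_itv/= => /andP[].
have bdp : unit_bounded (fun t : R => t ^+ N / N`!%:R).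
  split; first by apply: measurable_funM => //; exact: measurable_funX.
  exists 1 => t; rewrite in_itv/= => /andP[t0 t1].
  rewrite ger0_norm ?divr_ge0 ?exprn_ge0// ler_pdivrMr ?ltr0n ?fact_gt0//.
  by rewrite mul1r (@le_trans _ _ 1) ?exprn_ile1// ler1n fact_gt0.
have int h : unit_bounded h ->
    lebesgue_measure.-integrable `[0, x]%classic (EFin \o h).
  apply: (unit_bounded_integrable (lebesgue_unit_itv R)) => //.
  exact: sub_unit_itv.
have iv := int _ (cosine_remainder_unit_bounded N.+1).
rewrite sine_remainder_primitive// (le_trans (le_normr_Rintegral _ iv))//.
rewrite -Rintegral_divided_power// -RintegralZl//; last exact: int.
apply: le_Rintegral => //.
- exact: integrable_norm iv.
- exact/int/unit_boundedZ.
move=> t tx; have t01 := sub_unit_itv x01 tx.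
rewrite cosine_remainder_primitive// normrM normrN exprS.
rewrite [leRHS](_ : _ = `|Lam| * (`|M| * `|Lam| ^+ N * (t ^+ N / N`!%:R)));
  last by ring.
rewrite ler_wpM2l//.
(* For s <= t the inductive bound at s is at most the one at t, and [0, t] has [mu]-mass at most
   one. *)
apply: (normr_unit_Rintegral_le mu01) => //.
- exact: sub_unit_itv.
- exact: sine_remainder_unit_bounded.
- by rewrite !mulr_ge0 ?exprn_ge0//; move: t01; rewrite /= in_itv/= => /andP[].
move=> s st; rewrite (le_trans (IHN s (sub_unit_itv t01 st)))//.
rewrite ler_wpM2l ?mulr_ge0 ?exprn_ge0//.
rewrite ler_wpM2r ?invr_ge0//.
move: st; rewrite /= in_itv/= => /andP[s0 st].
by rewrite lerXn2r ?nnegrE ?(le_trans s0).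
Qed.

Lemma sine_remainder_cvg0 (x : R) : x \in `[0, 1] ->
  u n x @[n --> \oo] --> 0.
Proof.
move=> x01; have [M hM] := sine_remainder_le.
apply/norm_cvg0P.
have E0 : M * exp_coeff (`|Lam| * x) n @[n --> \oo] --> 0.
  (* The bound is a multiple of the general term of the exponential series at |Lam| x. *)
  by rewrite -[X in _ --> X](mulr0 M); apply: cvgMr; exact: cvg_exp_coeff.
apply: (squeeze_cvgr _ (cvg_cst 0) E0).
apply: nearW => n; rewrite normr_ge0/= (le_trans (hM n x x01))//.
by rewrite /exp_coeff/= exprMn !mulrA.
Qed.

(** Pass to the limit in the expansion. The division-free form also covers [g 0 = 0], where it
    forces sqrt(Lam) f to vanish on [0, 1]. *)
Lemma s_lambda_mu_eigenfunction (x : R) : 0 <= Lam -> x \in `[0, 1] ->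
  g 0 * s_lambda_mu mu (Num.sqrt Lam) x = Num.sqrt Lam * f x.
Proof.
move=> Lam0 x01; have u0 := sine_remainder_cvg0 x01.
set z := Num.sqrt Lam.
have partial n : g 0 * series (fun n => (-1) ^+ n * z ^+ (2 * n + 1) *
    q mu (2 * n + 1) x) n = z * (f x - u n x).
  rewrite /sine_remainder subKr /series /mk_sequence big_mkord mulrCA; congr (_ * _).
  rewrite mulr_sumr; apply: eq_bigr => i _.
  have -> : (2 * i + 1 = i.*2.+1)%N by rewrite mul2n addn1.
  move: (q mu i.*2.+1 x) => qx.
  by rewrite exprS -mul2n exprM sqr_sqrtr// -[- Lam]mulN1r exprMn; ring.
have fE : f x - u n x @[n --> \oo] --> f x.
  by rewrite -[X in _ --> X]subr0; apply: cvgB => //; exact: cvg_cst.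
(* If [g 0 = 0], every remainder is [f] itself, so f x = 0. Otherwise dividing by [g 0] yields
   convergence of the series. *)
have [g0|g0] := eqVneq (g 0) 0.
  rewrite g0 mul0r; have : f x - u n x @[n --> \oo] --> 0.
    rewrite (_ : (fun n => f x - u n x) = fun=> 0); first exact: cvg_cst.
    by apply/funext => n; rewrite /sine_remainder g0 mul0r subr0 subrr.
  by move=> /(cvg_unique _ fE) ->; rewrite ?mulr0.
apply: (mulfI (invr_neq0 g0)); rewrite mulKf//.
apply/cvg_lim => //.
rewrite (_ : series _ = fun n => (g 0)^-1 * (z * (f x - u n x))).
  by apply: cvgMr; exact: cvgMr.
by apply/funext => n; rewrite -partial mulKf.
Qed.

End remainders.

(** * Reflection of solutions *)

Hypothesis mu_non_atomic : non_atomic mu.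
Hypothesis mu_symmetric : symmetric_measure mu.

(** Reflection changes the sign of the derivative. The total Lebesgue integral of [g] is f 1 = 0, so
    the reflected function is again a primitive starting from 0. *)
Lemma left_dirichlet_system_reflect (Lam : R) (f g : R -> R) :
  left_dirichlet_system Lam f g -> f 1 = 0 ->
  left_dirichlet_system Lam (fun x => f (1 - x)) (fun x => - g (1 - x)).
Proof.
move=> [bf bg fE gE] f1.
have bgC := unit_boundedC bg.
have o01 : (1 : R) \in `[0, 1] by rewrite in_itv/= ler01 lexx.
split.
- exact: unit_boundedC.
- rewrite (_ : (fun x => _) = fun x => -1 * g (1 - x)); first exact: unit_boundedZ.
  by apply/funext => x; rewrite mulN1r.
- move=> x x01; rewrite fE ?in_unit_itvC//.
  rewrite (Rintegral_unit_primitiveC (lebesgue_unit_itv R))//; last 2 first.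
  + exact: lebesgue_measure_set1.
  + exact: lebesgue_symmetric.
  rewrite -fE// f1 sub0r -mulN1r -RintegralZl//; last first.
    apply: (unit_bounded_integrable (lebesgue_unit_itv R)) => //.
    exact: sub_unit_itv.
  by apply: eq_Rintegral => t _; rewrite mulN1r.
- move=> x x01; rewrite gE ?in_unit_itvC//.
  rewrite (Rintegral_unit_primitiveC mu01)//.
  (* The new initial value is [- g 1]; expanding it by the equation at 1 cancels the total integral
     of [f]. *)
  rewrite subr0 (gE 1)//; ring.
Qed.

End iterated_primitives.

(** * From square-integrable derivatives to bounded solutions *)

(** For a finite measure L2 lies in L1, so |f 0| plus the L1 norm of [h] on [0, 1] is a bound. *)
Lemma L2_unit_derivative_bounded (R : realType)
    (nu : {measure set (measurableTypeR R) -> \bar R}) (f h : R -> R) :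
  nu setT \is a fin_num -> is_nu_derivative nu f h ->
  exists M : R, forall x : R, x \in `[0, 1] -> `|f x| <= M.
Proof.
move=> nufin [/(Lfun_subset12 nufin)/Lfun1_integrable ih fE].
pose h0 : R -> R := h \_ `[0, 1]%classic.
have ih0 : nu.-integrable setT (EFin \o h0) by [].
exists (`|f 0| + \int[nu]_t `|h0 t|) => x x01; rewrite fE//.
rewrite (le_trans (ler_normD _ _))// lerD2l.
rewrite (eq_Rintegral nu (g := h0)); last first.
  move=> t; rewrite inE => /= tx; rewrite /h0 patchT// inE.
  exact: sub_unit_itv tx.
have ix : nu.-integrable `[0, x]%classic (EFin \o h0) by exact: integrableS ih0.
rewrite (le_trans (le_normr_Rintegral _ ix))//.
have in0 := integrable_norm ih0.
rewrite fine_le ?integrable_fin_num//; first exact: integrable_norm ix.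
apply: ge0_subset_integral => //; exact: measurable_int in0.
Qed.

Lemma dirichlet_eigenvalue_system (R : realType)
    (mu : probability (measurableTypeR R) R) (Lam : R) :
  on_unit_interval mu -> Lam != 0 -> dirichlet_eigenvalue mu Lam ->
  exists f g : R -> R,
    [/\ left_dirichlet_system mu Lam f g, f 1 = 0
      & exists2 x : R, x \in `[0, 1] & f x != 0].
Proof.
move=> mu01 Lam0 [f [g [fg gf f0 f1 fn0]]]; exists f, g; split => //.
have mg : measurable_fun (`[0, 1]%classic : set R) g.
  have [/andP[/[!inE]/= mg _] _] := fg.
  exact: (proj2 (measurable_restrictT g (measurable_itv `[0, 1])) mg).
have mf : measurable_fun (`[0, 1]%classic : set R) f.
  have [/andP[/[!inE]/= mf _] _] := gf.
  have {}mf := proj2 (measurable_restrictT _ (measurable_itv `[0, 1])) mf.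
  (* Measurability is known for [- Lam * f], as a derivative of [g]; it passes to [f] because Lam !=
     0. *)
  rewrite (_ : f = fun x => (- Lam)^-1 * (- Lam * f x)).
    exact: measurable_funM.
  by apply/funext => x; rewrite mulKf// oppr_eq0.
(* [g] is bounded first, as a primitive for the finite measure [mu]; [f] then inherits the bound as
   the Lebesgue primitive of [g]. *)
have [Mg hMg] := L2_unit_derivative_bounded (fin_num_measure mu setT measurableT) gf.
have bg : unit_bounded g by split => //; exists Mg.
have fE x : x \in `[0, 1] -> f x = \int[@lebesgue_measure R]_(t in `[0, x]) g t.
  by move=> x01; rewrite fg.2// f0 add0r.
have bf : unit_bounded f.
  split => //; exists `|Mg| => x x01; rewrite fE//.
  apply: (normr_unit_Rintegral_le (lebesgue_unit_itv R)) => //.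
    exact: sub_unit_itv.
  by move=> t tx; rewrite (le_trans (hMg t (sub_unit_itv x01 tx)))// ler_norm.
split => // x x01.
rewrite gf.2// (@RintegralZl _ _ _ mu) ?mulNr//.
by apply: (unit_bounded_integrable mu01) => //; exact: sub_unit_itv.
Qed.

(** * Symmetry or antisymmetry of the eigenfunctions *)

Unset Implicit Arguments.

Theorem proposition6p7 (R : realType)
    (mu : probability (measurableTypeR R) R)
    (mu01 : on_unit_interval mu)
    (mu_non_atomic : non_atomic mu)
    (mu_symmetric : symmetric_measure mu)
    (lamD : nat -> R)
    (lamDE : dirichlet_eigenvalues_are mu lamD)
    (m : nat) :
  (forall x : R, x \in `[0, 1] ->
     dirichlet_eigenfunction mu lamD m x
       = dirichlet_eigenfunction mu lamD m (1 - x)) \/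
  (forall x : R, x \in `[0, 1] ->
     dirichlet_eigenfunction mu lamD m x
       = - dirichlet_eigenfunction mu lamD m (1 - x)).
Proof.
rewrite /dirichlet_eigenfunction.
have ev : dirichlet_eigenvalue mu (lamD m) by apply/lamDE.2; exists m.
move: (lamD m) ev => Lam ev; have [Lam0|Lam0] := leP Lam 0.
  have S0 x : s_lambda_mu mu (Num.sqrt Lam) x = 0.
    rewrite (ler0_sqrtr Lam0) /s_lambda_mu (_ : series _ = fun=> 0) ?lim_cst//.
    apply/funext => n; rewrite /series/= big1// => i _.
    by rewrite addn1 expr0n/= mulr0 mul0r.
  by left => x _; rewrite !S0.
have Lam_neq0 : Lam != 0 by rewrite gt_eqF.
have [f [g [fg f1 [y y01 fy]]]] := dirichlet_eigenvalue_system mu01 Lam_neq0 ev.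
have fgC := left_dirichlet_system_reflect mu01 mu_non_atomic mu_symmetric fg f1.
set z := Num.sqrt Lam; set S := s_lambda_mu mu z.
have z0 : z != 0 by rewrite gt_eqF// sqrtr_gt0.
have SE x : x \in `[0, 1] -> g 0 * S x = z * f x.
  by apply: (s_lambda_mu_eigenfunction mu01 fg); exact: ltW.
have SCE x : x \in `[0, 1] -> - g 1 * S x = z * f (1 - x).
  move=> x01.
  have := s_lambda_mu_eigenfunction mu01 fgC (ltW Lam0) x01.
  by rewrite subr0.
have g0 : g 0 != 0.
  apply: contra_neq fy => g0; apply: (mulfI z0).
  by rewrite -SE// g0 mul0r mulr0.
(* The ratio of the initial slopes of the reflected solution and of [f]. *)
pose c := - g 1 / g 0.
have SC x : x \in `[0, 1] -> S (1 - x) = c * S x.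
  move=> x01; apply: (mulfI g0); rewrite SE ?in_unit_itvC// -SCE//.
  by rewrite mulrA /c mulrCA divff ?mulr1.
have Sy : S y != 0.
  by apply: contra_neq fy => Sy; apply: (mulfI z0); rewrite -SE// Sy !mulr0.
(* Reflecting twice at [y] gives S y = c^2 S y, and S y != 0. *)
have : c ^+ 2 == 1.
  rewrite -subr_eq0 -(mulIr_eq0 _ (mulIf Sy)) mulrBl mul1r subr_eq0.
  rewrite expr2 -mulrA -SC// -SC ?in_unit_itvC//.
  by rewrite opprB addrC subrK.
rewrite sqrf_eq1 => /orP[]/eqP c1; [left|right] => x x01.
  by rewrite SC// c1 mul1r.
by rewrite SC// c1 mulN1r opprK.
Qed.
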